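(* Let $q$ be a complex number with $0<|q|<1$ and let $u$ be a complex number. Then $$\sum_{i,j,k\geq 0} \frac{q^{3i^2+3j^2+4k^2+2ij+4ik+4jk-2j}u^{i+j+2k}}{(q^4;q^4)_i(q^4;q^4)_j(q^4;q^4)_k}= (-uq;q^2)_{\infty},$$ where the sum runs over all nonnegative integers $i,j,k$.
   Context: Notation: for $n\in\{0,1,2,\dots\}\cup\{\infty\}$, $(a;q)_n:=\prod_{k=0}^{n-1}(1-aq^k)$. The convention $u^0=1$ is used. *)

(* Defs.v *)
From HB Require Import structures.
From mathcomp Require Import all_boot all_order all_algebra finmap.
From mathcomp Require Import classical_sets boolp reals topology normedtype.
From mathcomp Require Import sequences.
From mathcomp Require Export complex.
From mathcomp.analysis Require Import showcase.summability.

Set Implicit Arguments.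
Unset Strict Implicit.
Unset Printing Implicit Defensive.

Import Order.TTheory GRing.Theory Num.Theory.
Import numFieldNormedType.Exports.

Local Open Scope classical_set_scope.
Local Open Scope ring_scope.

(* [complex] is not keyed as a [numFieldType], so R[i] does not inherit the
   topology and norm that every numFieldType carries; transfer them from the
   regular module R[i]^o. *)
HB.instance Definition _ (R : rcfType) := NormedModule.copy R[i] R[i]^o.

Definition qpoch {F : comNzRingType} (a q : F) (n : nat) : F :=
  \prod_(k < n) (1 - a * q ^+ k).

(* As with any [lim], the value is arbitrary if the partial products diverge;
   they converge whenever `|q| < 1. *)
Definition qpoch_inf {R : realType} (a q : R[i]) : R[i] :=
  lim (qpoch a q n @[n --> \oo]).

(* The finite partial sums converge to [s] along the finite subsets of [I]
   directed by inclusion. In R[i] this amounts to absolute convergence of the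
   family, so the order of summation is immaterial. *)
Definition unordered_sum {R : realType} {I : choiceType}
    (x : I -> R[i]) (s : R[i]) : Prop :=
  partial_sum x A @[A --> totally] --> s.

(* Main.v *)
Require Import Defs.
From mathcomp Require Import all_boot all_order all_algebra.
From mathcomp Require Import reals complex.
From mathcomp Require Import finmap classical_sets functions boolp filter.
From mathcomp Require Import topology normedtype sequences ring zify.
From mathcomp.analysis Require Import showcase.summability.

(** Put p = q^2, and let n = i + j + 2k be the power of u in the term of index
    (i, j, k). The exponent of q in that term is n^2 + 2 i^2 + 2 j (j - 1), so
    the terms with a given n add up to q^(n^2) u^n times the coefficient of z^n
    in the product of the three series

      sum_i p^(i^2) z^i / (p^2; p^2)_i       = (-zp; p^2)_oo,
      sum_j p^(j (j - 1)) z^j / (p^2; p^2)_j = (-z; p^2)_oo,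
      sum_k z^(2k) / (p^2; p^2)_k            = 1 / (z^2; p^2)_oo.

    The product is (-z; p)_oo / (z^2; p^2)_oo = 1 / (z; p)_oo, whose coefficient
    of z^n is 1 / (p; p)_n [sum_fixed_degree]. None of the infinite products is
    needed for this: if H is the product of the three series, the dilation
    z -> pz acts on each factor in a simple way and gives H(pz) = (1 - z) H(z),
    which determines the coefficients recursively from the constant term. The
    computation is done with polynomial truncations of the series.

    What remains is Euler's identity sum_n q^(n^2) u^n / (q^2; q^2)_n
    = (-uq; q^2)_oo [cvg_euler_sum]. If F(u) is the left-hand side, then
    F(u) = (1 + uq) F(u q^2); hence F(u) is the m-th partial product times
    F(u q^(2m)), and F(u q^(2m)) tends to F(0) = 1.

    For the passage from sums by degree to unordered sums, the triple series is
    dominated: the Gaussian decay of |q|^(i^2 + j^2 + k^2) beats every geometric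
    growth, so the terms are O(4^-n) [norm_term_le], and the terms of degree at
    least N have total norm O(2^-N) [unordered_sum_by_degree]. *)

Set Implicit Arguments.
Unset Strict Implicit.
Unset Printing Implicit Defensive.

Import Order.TTheory GRing.Theory Num.Theory.
Import numFieldNormedType.Exports.

Local Open Scope classical_set_scope.
Local Open Scope ring_scope.

(** * Triples of indices graded by the power of u *)

Definition degree (t : nat * nat * nat) : nat :=
  let: (i, j, k) := t in (i + j + 2 * k)%N.

Definition coords {N : nat} (b : 'I_N * 'I_N * 'I_N) : nat * nat * nat :=
  (val b.1.1, val b.1.2, val b.2).

Lemma coords_inj N : injective (@coords N).
Proof.
by move=> [[i j] k] [[i' j'] k'] [/val_inj -> /val_inj -> /val_inj ->].
Qed.

Lemma coords_onto N t :
  (degree t < N)%N -> exists b : 'I_N * 'I_N * 'I_N, coords b = t.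
Proof.
case: t => [[i j] k] /= tN.
have [iN jN kN] : [/\ i < N, j < N & k < N]%N by split; lia.
by exists (Ordinal iN, Ordinal jN, Ordinal kN).
Qed.

(** Sums over finite sets of triples are all brought to one finite index type,
    the box ['I_N * 'I_N * 'I_N], where they can be compared and factored. *)
Lemma big_box {V : nmodType} (s : seq (nat * nat * nat)) (N : nat)
    (f : nat * nat * nat -> V) :
  uniq s -> {in s, forall t, degree t < N}%N ->
  \sum_(t <- s) f t =
  \sum_(b : 'I_N * 'I_N * 'I_N | coords b \in s) f (coords b).
Proof.
move=> us sN.
rewrite -[RHS]big_filter -(big_map (@coords N) predT f).
apply: perm_big; apply: uniq_perm => //.
  by rewrite map_inj_uniq ?filter_uniq ?index_enum_uniq //; exact: coords_inj.
move=> t; apply/idP/mapP => [ts|[b + ->]]; last by rewrite mem_filter => /andP[].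
have [b bt] := coords_onto (sN t ts).
by exists b; rewrite // mem_filter bt ts mem_index_enum.
Qed.

Lemma sum_by_degree {V : nmodType} N (f : nat * nat * nat -> V) :
  \sum_(n < N)
     \sum_(b : 'I_N * 'I_N * 'I_N | degree (coords b) == n) f (coords b) =
  \sum_(b : 'I_N * 'I_N * 'I_N | (degree (coords b) < N)%N) f (coords b).
Proof.
rewrite (exchange_big_dep (fun b => degree (coords b) < N)%N) /=; last first.
  by move=> n b _ /eqP ->.
by apply: eq_bigr => b bN; rewrite (big_pred1 (Ordinal bN)).
Qed.

Lemma squares_le_degree i j k :
  (i ^ 2 + j ^ 2 + k ^ 2 <= (i + j + 2 * k) ^ 2)%N.
Proof. by rewrite -!mulnn; nia. Qed.

Lemma degree_le_double i j k :
  (i + j + 2 * k <= 2 * i + 2 * j + 2 * k)%N.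
Proof. by lia. Qed.

(** * The coefficient identity *)

Lemma qpochS {F : comNzRingType} (a q : F) (n : nat) :
  qpoch a q n.+1 = qpoch a q n * (1 - a * q ^+ n).
Proof. by rewrite /qpoch big_ord_recr. Qed.

Lemma qfactor_neq0 {F : fieldType} (p : F) d n :
  (forall n, p ^+ n.+1 != 1) -> 1 - p ^+ d.+1 * (p ^+ d.+1) ^+ n != 0.
Proof.
by move=> p_neq1; rewrite subr_eq0 eq_sym -exprS -exprM mulSn addSn p_neq1.
Qed.

Lemma qpoch_neq0 {F : fieldType} (p : F) d n :
  (forall n, p ^+ n.+1 != 1) -> qpoch (p ^+ d.+1) (p ^+ d.+1) n != 0.
Proof.
move=> p_neq1; elim: n => [|n IH]; first by rewrite /qpoch big_ord0 oner_eq0.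
by rewrite qpochS mulf_neq0 // qfactor_neq0.
Qed.

Lemma coef_dilate {F : fieldType} (c : F) (f : {poly F}) (n : nat) :
  (f \Po (c *: 'X))`_n = c ^+ n * f`_n.
Proof.
rewrite -{1}[f]coefK poly_def raddf_sum /= coef_sum.
transitivity (\sum_(i < size f) if n == i then c ^+ n * f`_n else 0).
  apply: eq_bigr => i _; rewrite linearZ /= comp_Xn_poly exprZn !coefZ coefXn.
  by case: eqP => [->|_]; rewrite ?mulr1 ?mulr0 // mulrC.
case: (ltnP n (size f)) => nf.
  rewrite (bigD1 (Ordinal nf)) //= eqxx big1 ?addr0 // => i ne.
  by case: eqP => // eni; case/eqP: ne; apply: val_inj.
rewrite big1 => [|i _]; first by rewrite nth_default ?mulr0.
by case: eqP => // eni; have := ltn_ord i; rewrite -eni ltnNge nf.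
Qed.

Lemma dilate_sum {F : fieldType} (f : nat -> F) N d c :
  (\sum_(i < N) f i *: 'X^(d * i)) \Po (c *: 'X) =
  \sum_(i < N) (c ^+ (d * i) * f i) *: 'X^(d * i).
Proof.
rewrite raddf_sum; apply: eq_bigr => i _ /=.
by rewrite linearZ /= comp_Xn_poly exprZn scalerA mulrC.
Qed.

Lemma coef_prod3 {F : fieldType} (a b c : nat -> F) (N n : nat) :
  ((\sum_(i < N) a i *: 'X^i) * (\sum_(j < N) b j *: 'X^j)
     * (\sum_(k < N) c k *: 'X^(2 * k)))`_n =
  \sum_(t : 'I_N * 'I_N * 'I_N | degree (coords t) == n)
     a t.1.1 * b t.1.2 * c t.2.
Proof.
rewrite big_distrlr /= pair_big /= big_distrlr /= pair_big /= coef_sum.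
rewrite [RHS]big_mkcond /=; apply: eq_bigr => -[[i j] k] _ /=.
rewrite -!mul_polyC.
have -> : (a i)%:P * 'X^i * ((b j)%:P * 'X^j) * ((c k)%:P * 'X^(2 * k))
    = (a i * b j * c k)%:P * 'X^(i + j + 2 * k).
  by rewrite !polyCM !exprD; ring.
rewrite coefCM coefXn eq_sym.
by case: eqP => _; rewrite ?mulr1 ?mulr0.
Qed.

(** The coefficient of z^i in (-zp; p^2)_oo, the product of 1 + z p^m over the
    odd m. *)
Definition odd_coef {F : fieldType} (p : F) (i : nat) : F :=
  p ^+ (i ^ 2) / qpoch (p ^+ 2) (p ^+ 2) i.

(** The coefficient of z^j in (-z; p^2)_oo, the product of 1 + z p^m over the
    even m. *)
Definition even_coef {F : fieldType} (p : F) (j : nat) : F :=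
  p ^+ (j * j.-1) / qpoch (p ^+ 2) (p ^+ 2) j.

(** The coefficient of z^(2k) in 1 / (z^2; p^2)_oo. *)
Definition square_coef {F : fieldType} (p : F) (k : nat) : F :=
  (qpoch (p ^+ 2) (p ^+ 2) k)^-1.

(** The substitution z -> pz turns the even factors into the odd ones. *)
Lemma even_coef_dilate {F : fieldType} (p : F) j :
  p ^+ j * even_coef p j = odd_coef p j.
Proof.
rewrite /even_coef mulrA -exprD; congr (_ ^+ _ / _).
by case: j => // j /=; rewrite -mulnn; lia.
Qed.

(** This is (-z; p^2)_oo = (1 + z) (-z p^2; p^2)_oo: the even factors are
    1 + z and the dilated odd ones. *)
Lemma even_coefS {F : fieldType} (p : F) j : (forall n, p ^+ n.+1 != 1) ->
  even_coef p j.+1 = p ^+ j.+1 * odd_coef p j.+1 + p ^+ j * odd_coef p j.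
Proof.
move=> p_neq1; rewrite /even_coef /odd_coef qpochS /=.
have h1 := qpoch_neq0 1 j p_neq1; have h2 := qfactor_neq0 1 j p_neq1.
have -> : (j.+1 * j = j ^ 2 + j)%N by rewrite -mulnn; lia.
have -> : (j.+1 ^ 2 = j ^ 2 + j + j + 1)%N by rewrite -!mulnn; lia.
have e2 : (p ^+ 2) ^+ j = (p ^+ j) ^+ 2 by rewrite -!exprM mulnC.
rewrite !exprD expr1 [p ^+ j.+1]exprS e2; rewrite e2 in h2.
move: h1 h2; move: (qpoch _ _ j) (p ^+ (j ^ 2)) (p ^+ j) => Q z y h1 h2.
by field; rewrite exprMn h1.
Qed.

(** This is 1 / (z^2 p^2; p^2)_oo = (1 - z^2) / (z^2; p^2)_oo. *)
Lemma square_coefS {F : fieldType} (p : F) k : (forall n, p ^+ n.+1 != 1) ->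
  p ^+ (2 * k.+1) * square_coef p k.+1 = square_coef p k.+1 - square_coef p k.
Proof.
move=> p_neq1; rewrite /square_coef qpochS.
have h1 := qpoch_neq0 1 k p_neq1; have h2 := qfactor_neq0 1 k p_neq1.
rewrite exprM exprS; move: h1 h2.
move: (qpoch _ _ k) ((p ^+ 2) ^+ k) => Q y h1 h2.
by field; rewrite h1.
Qed.

(** This is H(pz) = (1 - z) H(z), read off below the degree N at which the
    series are truncated. *)
Lemma prod3_recurrence {F : fieldType} (p : F) N n :
  (forall n, p ^+ n.+1 != 1) -> (0 < n < N)%N ->
  let H := (\sum_(i < N) odd_coef p i *: 'X^i)
     * (\sum_(j < N) even_coef p j *: 'X^j)
     * (\sum_(k < N) square_coef p k *: 'X^(2 * k)) in
  p ^+ n * H`_n = H`_n - H`_n.-1.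
Proof.
move=> p_neq1 /andP[n0 nN] H.
case: N nN @H => [//|N] nN H.
pose A := \sum_(i < N.+1) odd_coef p i *: 'X^i.
pose A' := \sum_(i < N.+1) (p ^+ i * odd_coef p i) *: 'X^i.
pose B := \sum_(i < N.+1) even_coef p i *: 'X^i.
pose C := \sum_(i < N.+1) square_coef p i *: 'X^(2 * i).
have dA : A \Po (p *: 'X) = A'.
  have := dilate_sum (odd_coef p) N.+1 1 p.
  under eq_bigr do rewrite mul1n.
  by move=> ->; apply: eq_bigr => i _; rewrite mul1n.
have dB : B \Po (p *: 'X) = A.
  have := dilate_sum (even_coef p) N.+1 1 p.
  under eq_bigr do rewrite mul1n.
  by move=> ->; apply: eq_bigr => i _; rewrite mul1n even_coef_dilate.
(* Each truncated identity has one boundary term, a multiple of 'X^(N.+1). *)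
have eB : B = (1 + 'X) * A' - (p ^+ N * odd_coef p N) *: 'X^(N.+1).
  rewrite mulrDl mul1r /A' /B mulr_sumr big_ord_recl.
  rewrite [X in X + _ - _]big_ord_recl [X in _ + X - _]big_ord_recr /=.
  rewrite -scalerAr -exprS addrA addrK -addrA.
  rewrite {1}/even_coef {1}/odd_coef /qpoch !big_ord0 !mul0n; congr (_ *: _ + _).
    by rewrite exp0n // !expr0 !mul1r.
  rewrite -big_split /=; apply: eq_bigr => i _.
  by rewrite -scalerAr -exprS -scalerDl -even_coefS.
have dC : C \Po (p *: 'X) =
    (1 - 'X^2) * C + square_coef p N *: 'X^(2 * N.+1).
  rewrite /C dilate_sum mulrBl mul1r mulr_sumr big_ord_recl.
  rewrite [X in X - _ + _]big_ord_recl [X in _ - X + _]big_ord_recr /=.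
  rewrite -scalerAr -exprD -mulnS opprD addrA subrK -addrA.
  rewrite muln0 mul1r; congr (_ + _).
  rewrite -sumrB; apply: eq_bigr => i _.
  by rewrite square_coefS // scalerBl -scalerAr -exprD mulnS.
have dH : H \Po (p *: 'X) = H - 'X * H + 'X^(N.+1) *
    ((1 - 'X) * A * C * (p ^+ N * odd_coef p N)%:P
     + A * A' * (square_coef p N)%:P * 'X^(N.+1)).
  rewrite /H !comp_polyM -/A -/B -/C dA dB dC eB -!mul_polyC mul2n -addnn exprD.
  have key (R : comNzRingType) (a a' c x y z v : R) :
      a' * a * ((1 - v ^+ 2) * c + z * (y * y)) =
      a * ((1 + v) * a' - x * y) * c - v * (a * ((1 + v) * a' - x * y) * c)
      + y * ((1 - v) * a * c * x + a * a' * z * y) by ring.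
  exact: key.
rewrite -coef_dilate dH coefD coefB coefXM coefXnM nN addr0.
by rewrite (gtn_eqF n0).
Qed.

Lemma sum_fixed_degree {F : fieldType} (p : F) N n :
  (forall n, p ^+ n.+1 != 1) -> (n < N)%N ->
  \sum_(b : 'I_N * 'I_N * 'I_N | degree (coords b) == n)
     odd_coef p b.1.1 * even_coef p b.1.2 * square_coef p b.2
  = (qpoch p p n)^-1.
Proof.
move=> p_neq1; rewrite -coef_prod3; elim: n => [|n IH] nN.
  case: N nN => // N _.
  have constant_term (f : nat -> F) (g : nat -> nat) :
      (forall i, (g i.+1 > 0)%N) ->
      (\sum_(i < N.+1) f i *: 'X^(g i))`_0 = f 0%N * (g 0%N == 0%N)%:R.
    move=> g_gt0; rewrite coef_sum big_ord_recl big1 ?addr0 => [|i _].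
      by rewrite coefZ coefXn eq_sym.
    by rewrite coefZ coefXn ltn_eqF ?g_gt0 // mulr0.
  rewrite !coef0M !(constant_term _ (fun i => i)) //.
  rewrite (constant_term _ (muln 2)) // /odd_coef /even_coef /square_coef.
  by rewrite /qpoch !big_ord0 exp0n // !expr0 !invr1 !mulr1.
have /= := @prod3_recurrence _ p N n.+1 p_neq1 nN; rewrite IH ?(ltnW nN) //=.
set h := (X in _ * X = _) => e.
have h1 : 1 - p * p ^+ n != 0 by exact: (qfactor_neq0 0 n p_neq1).
rewrite qpochS invfM -[LHS](mulfK h1); congr (_ / _).
by rewrite mulrBr mulr1 -exprS [h * _]mulrC e; ring.
Qed.

(** * Sequences and series over numeric fields and the complex numbers *)

Lemma cvg_seqP {K : numFieldType} (f : nat -> K) (a : K) :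
  f @ \oo --> a <->
  (forall e : K, 0 < e -> exists N, forall n, (N <= n)%N -> `|a - f n| < e).
Proof.
split=> [/cvgrPdist_lt h e /h [N _ hN]|h]; first by exists N => n; exact: hN.
by apply/cvgrPdist_lt => e /h [N hN]; exists N.
Qed.

(** The partial products of an infinite product are the first factor of such a
    factorisation; this form yields their convergence along with the limit. *)
Lemma cvg_cofactor {K : numFieldType} (f g : nat -> K) (a : K) :
  (forall n, f n * g n = a) -> g @ \oo --> (1 : K) -> f @ \oo --> a.
Proof.
move=> fg g1.
have e : \forall n \near \oo, a * (g n)^-1 = f n.
  near=> n; have gn0 : g n != 0.
    by near: n; exact: (@cvgr_neq0 K K _ \oo _ g 1 g1 (oner_neq0 K)).
  by rewrite -(fg n) mulfK.
apply: cvg_trans; first exact: (near_eq_cvg e).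
have := cvgM (@cvg_cst _ a _ \oo _) (cvgV (oner_neq0 _) g1).
rewrite invr1 mulr1; exact.
Unshelve. all: by end_near.
Qed.

Lemma lim_recurrence {K : numFieldType} (f g : nat -> K) (a b c : K) :
  f @ \oo --> a -> g @ \oo --> b ->
  (forall n, f n.+1 = g n.+1 + c * g n) -> a = (1 + c) * b.
Proof.
move=> fa gb fg.
have fa' : (fun n => f n.+1) @ \oo --> a by rewrite (cvg_shiftS f).
have gb' : (fun n => g n.+1) @ \oo --> b by rewrite (cvg_shiftS g).
have h := cvgD gb' (cvgM (@cvg_cst _ c _ \oo _) gb).
have e : (fun n => f n.+1) = (fun n => g n.+1) \+ (cst c \* g) by apply/funext.
rewrite mulrDl mul1r; rewrite e in fa'.
rewrite -(cvg_lim (@norm_hausdorff K K) fa').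
exact: (cvg_lim (@norm_hausdorff K K) (h _ _ _)).
Qed.

Lemma ler_pM3 {K : numDomainType} (x y z x' y' z' : K) :
  0 <= x -> 0 <= y -> 0 <= z -> x <= x' -> y <= y' -> z <= z' ->
  x * y * z <= x' * y' * z'.
Proof.
by move=> x0 y0 z0 xx' yy' zz'; apply: ler_pM => //;
  [exact: mulr_ge0|exact: ler_pM].
Qed.

Lemma sum_half_le {K : numFieldType} (N : nat) :
  \sum_(i < N) (2^-1 : K) ^+ i <= 2.
Proof.
suff -> : \sum_(i < N) (2^-1 : K) ^+ i = 2 - 2 * 2^-1 ^+ N.
  by rewrite gerBl mulr_ge0 // exprn_ge0 // invr_ge0.
elim: N => [|N IH]; first by rewrite big_ord0 expr0 mulr1 subrr.
by rewrite big_ord_recr /= IH exprS mulVKf ?pnatr_eq0 //; ring.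
Qed.

Lemma pos_complexE {R : realType} (e : R[i]) :
  0 < e -> exists2 r : R, 0 < r & e = real_complex R r.
Proof.
by move=> e0; exists (complex.Re e); rewrite -?ltcR RRe_real // gtr0_real.
Qed.

Lemma norm_complexE {R : realType} (z : R[i]) :
  exists2 r : R, 0 <= r & `|z| = real_complex R r.
Proof.
exists (Num.sqrt (complex.Re z ^+ 2 + complex.Im z ^+ 2)).
  exact: sqrtr_ge0.
by rewrite normc_def.
Qed.

Lemma norm_expr_small {R : realType} (z e : R[i]) :
  `|z| < 1 -> 0 < e -> exists N, forall n, (N <= n)%N -> `|z| ^+ n < e.
Proof.
have [r r0 ->] := norm_complexE z.
rewrite -[1]/(real_complex R 1) ltcR => r1 /pos_complexE[d d0 ->].
have : `|r| < 1 by rewrite ger0_norm.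
move=> /cvg_expr/cvg_seqP/(_ d d0)[N h]; exists N => n /h.
by rewrite sub0r normrN ger0_norm ?exprn_ge0 // -rmorphXn ltcR.
Qed.

(** Gaussian decay beats geometric growth: once [`|z| ^+ n * M] is at most 1, so
    is its n-th power; the finitely many earlier terms are bounded by a power of
    [1 + M]. *)
Lemma gauss_bound {R : realType} (z M : R[i]) : `|z| < 1 -> 0 <= M ->
  exists2 D, 0 <= D & forall n, `|z| ^+ (n ^ 2) * M ^+ n <= D.
Proof.
move=> z1 M0.
have M1 : 0 < 1 + M by rewrite ltr_pwDl.
have [N hN] := norm_expr_small z1 (divr_gt0 ltr01 M1).
exists ((1 + M) ^+ N); first by rewrite exprn_ge0 // ltW.
move=> n; have le1 : 1 <= 1 + M by rewrite lerDl.
have h1 : M ^+ n <= (1 + M) ^+ n.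
  by apply: lerXn2r; rewrite ?nnegrE ?lerDr ?ler01 ?(ltW M1).
case: (leqP N n) => Nn.
  apply: (@le_trans _ _ 1); last by rewrite exprn_ege1.
  have -> : `|z| ^+ (n ^ 2) * M ^+ n = (`|z| ^+ n * M) ^+ n.
    by rewrite exprMn -exprM mulnn.
  apply: exprn_ile1; first by rewrite mulr_ge0 // exprn_ge0.
  apply: (@le_trans _ _ (`|z| ^+ n * (1 + M))).
    by rewrite ler_wpM2l ?exprn_ge0 // lerDr.
  by have := ltW (hN n Nn); rewrite ler_pdivlMr.
apply: (@le_trans _ _ ((1 + M) ^+ n)); last by rewrite ler_weXn2l // ltnW.
by apply: (le_trans _ h1); rewrite ler_piMl ?exprn_ge0 // exprn_ile1 // ltW.
Qed.

(** A bound that grows with n is enough here, because it is always multiplied by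
    a Gaussian factor. *)
Lemma norm_inv_qpoch_le {R : realType} (s : R[i]) n : `|s| < 1 ->
  `|(qpoch s s n)^-1| <= (1 - `|s|)^-1 ^+ n.
Proof.
move=> s1; have d0 : 0 < 1 - `|s| by rewrite subr_gt0.
rewrite normfV exprVn /qpoch normr_prod.
have h : (1 - `|s|) ^+ n <= \prod_(k < n) `|1 - s * s ^+ k|.
  rewrite -[n in _ ^+ n]card_ord -prodr_const; apply: ler_prod => k _.
  rewrite ltW //=; apply: le_trans (lerB_dist _ _).
  by rewrite normr1 lerD2l lerN2 -exprS normrX exprS ler_piMr // exprn_ile1 // ltW.
rewrite lef_pV2 // posrE; last by rewrite exprn_gt0.
by apply: lt_le_trans h; rewrite exprn_gt0.
Qed.

(** The real and imaginary parts are dominated by the same geometric series, so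
    completeness of the reals applies to each of them. *)
Lemma cvg_dominated_series {R : realType} (x : nat -> R[i]) (D : R[i]) :
  (forall n, `|x n| <= D * 2^-1 ^+ n) ->
  exists l : R[i], (fun N => \sum_(n < N) x n) @ \oo --> l.
Proof.
move=> hx.
have D0 : 0 <= D.
  by have := le_trans (normr_ge0 _) (hx 0%N); rewrite expr0 mulr1.
have [d dE] : exists d : R, D = real_complex R d.
  by exists (complex.Re D); rewrite RRe_real // ger0_real.
have real_cvg (y : nat -> R) : (forall n, `|real_complex R (y n)| <= `|x n|) ->
    exists l : R, series y @ \oo --> l.
  move=> hy.
  suff : cvgn (series y) by move=> h; exists (limn (series y)).
  apply: normed_cvg; apply: (@series_le_cvg _ _ (geometric d 2^-1)) => [n|n|n|].
  - exact: normr_ge0.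
  - by rewrite /= mulr_ge0 ?exprn_ge0 ?invr_ge0 // -lecR -dE.
  - have := le_trans (hy n) (hx n).
    rewrite {1}normc_def /= expr0n addr0 sqrtr_sqr -lecR.
    by rewrite dE rmorphM rmorphXn fmorphV rmorph_nat.
  - apply: is_cvg_geometric_series.
    by rewrite ger0_norm ?invr_ge0 // invf_lt1 // ltr1n.
have [a ha] : exists l : R, series (fun n => complex.Re (x n)) @ \oo --> l.
  apply: real_cvg => n; apply: le_trans (normc_ge_Re (x n)).
  by rewrite normc_def /= expr0n addr0 sqrtr_sqr.
have [b hb] : exists l : R, series (fun n => complex.Im (x n)) @ \oo --> l.
  apply: real_cvg => n; rewrite !normc_def lecR /= expr0n addr0.
  by rewrite ler_sqrt ?lerDr ?sqr_ge0 // addr_ge0 ?sqr_ge0.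
exists (Complex a b); apply/cvg_seqP => e /pos_complexE[r r0 ->].
have r20 : 0 < r / 2 by rewrite divr_gt0.
have [N1 h1] := (cvg_seqP _ _).1 ha _ r20.
have [N2 h2] := (cvg_seqP _ _).1 hb _ r20.
exists (maxn N1 N2) => n; rewrite geq_max => /andP[n1 n2].
have -> : \sum_(k < n) x k =
    Complex (series (fun n => complex.Re (x n)) n)
            (series (fun n => complex.Im (x n)) n).
  elim: n {n1 n2} => [|n IH]; first by rewrite big_ord0 /series /= !big_geq.
  by rewrite big_ord_recr /= IH /series /= !big_nat_recr //=; case: (x n).
have := h1 _ n1; have := h2 _ n2.
move: (series _ n) (series _ n) => v w hv hw.
rewrite normc_def ltcR /=.
apply: (@le_lt_trans _ _ (`|a - v| + `|b - w|)).
  have -> : `|a - v| + `|b - w| = Num.sqrt ((`|a - v| + `|b - w|) ^+ 2).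
    by rewrite sqrtr_sqr [RHS]ger0_norm // addr_ge0 // normr_ge0.
  rewrite ler_sqrt ?sqr_ge0 // [leRHS]sqrrD !real_normK ?num_real //.
  by rewrite addrAC lerDl mulrn_wge0 // mulr_ge0.
by rewrite [ltRHS]splitr ltrD.
Qed.

(** * Euler's identity *)

Definition euler_coef {F : fieldType} (q : F) (n : nat) : F :=
  q ^+ (n ^ 2) / qpoch (q ^+ 2) (q ^+ 2) n.

Definition euler_sum {F : fieldType} (q u : F) (N : nat) : F :=
  \sum_(n < N) euler_coef q n * u ^+ n.

Lemma expr_neq1 {K : numDomainType} (q : K) n : `|q| < 1 -> q ^+ n.+1 != 1.
Proof.
move=> q1; apply/eqP => e; have := congr1 Num.norm e.
rewrite normr1 normrX => /eqP; rewrite pexprn_eq1 //= => /eqP e1.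
by rewrite e1 ltxx in q1.
Qed.

Lemma norm_expr_lt1 {K : numDomainType} (q : K) d :
  `|q| < 1 -> `|q ^+ d.+1| < 1.
Proof. by move=> q1; rewrite normrX exprn_ilt1. Qed.

Lemma euler_coefS {F : fieldType} (q : F) n : (forall n, q ^+ n.+1 != 1) ->
  euler_coef q n.+1 * (1 - (q ^+ 2) ^+ n.+1)
  = q * (q ^+ 2) ^+ n * euler_coef q n.
Proof.
move=> q_neq1; rewrite /euler_coef qpochS.
have h1 := qpoch_neq0 1 n q_neq1; have h2 := qfactor_neq0 1 n q_neq1.
have -> : q ^+ (n.+1 ^ 2) = q ^+ (n ^ 2) * (q ^+ 2) ^+ n * q.
  by rewrite -exprM -exprD -exprSr; congr (_ ^+ _); rewrite -!mulnn; lia.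
rewrite [(q ^+ 2) ^+ n.+1]exprS; move: h1 h2.
move: (qpoch _ _ n) (q ^+ (n ^ 2)) ((q ^+ 2) ^+ n) => Q z y h1 h2.
by field; rewrite h1.
Qed.

(** The truncated form of F(u) = (1 + uq) F(u q^2). *)
Lemma euler_sum_dilate {F : fieldType} (q u : F) N :
  (forall n, q ^+ n.+1 != 1) ->
  euler_sum q u N.+1 =
  euler_sum q (u * q ^+ 2) N.+1 + u * q * euler_sum q (u * q ^+ 2) N.
Proof.
move=> q_neq1; rewrite /euler_sum big_ord_recl [in RHS]big_ord_recl !expr0.
rewrite -addrA; congr (_ + _).
rewrite mulr_sumr -big_split; apply: eq_bigr => n _ /=.
rewrite /bump /= add1n.
have e : euler_coef q n.+1 =
    euler_coef q n.+1 * (q ^+ 2) ^+ n.+1 + q * (q ^+ 2) ^+ n * euler_coef q n.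
  by rewrite -euler_coefS //; ring.
by rewrite {1}e !exprMn !exprS; ring.
Qed.

Lemma norm_euler_term_le {R : realType} (q u : R[i]) : `|q| < 1 ->
  exists D : R[i], forall n, `|euler_coef q n * u ^+ n| <= D * 2^-1 ^+ n.
Proof.
move=> q1; have k0 : 0 < 1 - `|q ^+ 2| by rewrite subr_gt0 norm_expr_lt1.
set K := (1 - `|q ^+ 2|)^-1.
have K0 : 0 <= K by rewrite invr_ge0 ltW.
have M0 : 0 <= 2 * (K * `|u|) by rewrite !mulr_ge0.
have [D D0 hD] := gauss_bound q1 M0.
exists D => n; rewrite exprVn ler_pdivlMr ?exprn_gt0 //.
apply: le_trans (hD n).
rewrite !normrM !normrX [in leRHS]exprMn [(K * _) ^+ n]exprMn.
rewrite [leLHS]mulrC [leRHS]mulrCA ler_wpM2l ?exprn_ge0 // -!mulrA.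
rewrite ler_wpM2l ?exprn_ge0 // ler_wpM2r ?exprn_ge0 //.
exact: norm_inv_qpoch_le (norm_expr_lt1 1 q1).
Qed.

(** Continuity of the sum of the series at the origin, uniformly in the
    truncation. *)
Lemma euler_sum_near1 {R : realType} (q u : R[i]) : `|q| < 1 ->
  exists2 D : R[i], 0 <= D & forall w N, `|w| <= 1 ->
    `|euler_sum q (u * w) N.+1 - 1| <= D * `|w|.
Proof.
move=> q1; have [D hD] := norm_euler_term_le u q1.
have D0 : 0 <= D.
  by have := le_trans (normr_ge0 _) (hD 0%N); rewrite expr0 mulr1.
exists (D * 2); first by rewrite mulr_ge0.
move=> w N w1.
have e0 : euler_coef q 0 = 1.
  by rewrite /euler_coef /qpoch big_ord0 exp0n // expr0 divr1.
rewrite /euler_sum big_ord_recl e0 expr0 mulr1 addrC addKr.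
apply: le_trans (ler_norm_sum _ _ _) _.
apply: (@le_trans _ _ (\sum_(n < N) `|w| * (D * 2^-1 ^+ n))).
  apply: ler_sum => n _; rewrite lift0 exprMn mulrA normrM mulrC.
  apply: ler_pM => //.
    by rewrite normrX exprS ler_piMr // exprn_ile1.
  apply: le_trans (hD n.+1) _.
  rewrite ler_wpM2l // exprS ler_piMl ?exprn_ge0 ?invr_ge0 //.
  by rewrite invf_le1 // ler1n.
rewrite -mulr_sumr mulrC ler_wpM2r // -mulr_sumr ler_wpM2l //.
exact: sum_half_le.
Qed.

Lemma cvg_euler_sum {R : realType} (q u : R[i]) : `|q| < 1 ->
  euler_sum q u @ \oo --> qpoch_inf (- u * q) (q ^+ 2).
Proof.
move=> q1.
have q_neq1 n : q ^+ n.+1 != 1 by exact: expr_neq1.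
have ex v : exists l : R[i], euler_sum q v @ \oo --> l.
  have [D hD] := norm_euler_term_le v q1; exact: cvg_dominated_series hD.
have [F hF] : exists F : R[i] -> R[i], forall v, euler_sum q v @ \oo --> F v.
  by have [F hF] := boolp.choice ex; exists F.
have F_dilate v : F v = (1 + v * q) * F (v * q ^+ 2).
  apply: lim_recurrence (hF v) (hF (v * q ^+ 2)) _ => N.
  exact: euler_sum_dilate.
have F_prod : forall m,
    qpoch (- u * q) (q ^+ 2) m * F (u * (q ^+ 2) ^+ m) = F u.
  elim=> [|m <-]; first by rewrite /qpoch big_ord0 mul1r expr0 mulr1.
  rewrite qpochS [in RHS]F_dilate [_ ^+ m.+1]exprSr [u * (_ * _)]mulrA -mulrA.
  by congr (_ * (_ * _)); ring.
have F1 : (fun m => F (u * (q ^+ 2) ^+ m)) @ \oo --> (1 : R[i]).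
  apply/cvg_seqP => e e0.
  have [D D0 hD] := euler_sum_near1 u q1.
  have e20 : 0 < e / 2 by rewrite divr_gt0.
  have D1 : 0 < 1 + D by rewrite ltr_pwDl.
  have [m0 hm] := norm_expr_small (norm_expr_lt1 1 q1) (divr_gt0 e20 D1).
  exists m0 => m m0m; have := hm m m0m.
  rewrite -normrX ltr_pdivlMr // => {}hm.
  set w := (q ^+ 2) ^+ m in hm *.
  have w1 : `|w| <= 1 by rewrite normrX exprn_ile1 // ltW // norm_expr_lt1.
  have [N hN] := (cvg_seqP _ _).1 (hF (u * w)) _ e20.
  have := hN _ (leqnSn N); have := hD w N w1.
  move: (euler_sum _ _ _) => s h1 h2.
  have -> : 1 - F (u * w) = - ((F (u * w) - s) + (s - 1)) by ring.
  rewrite normrN; apply: le_lt_trans (ler_normD _ _) _; rewrite [ltRHS]splitr.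
  rewrite ltrD //; apply: le_lt_trans h1 (le_lt_trans _ hm).
  by rewrite mulrDr mulr1 mulrC lerDr.
rewrite /qpoch_inf.
have -> := cvg_lim (@norm_hausdorff R[i] R[i]) (cvg_cofactor F_prod F1).
exact: hF.
Qed.

(** * Unordered sums of dominated families *)

(** The sum over a box factors into three geometric series, once the weight
    2^-(2k) of the last coordinate is relaxed to 2^-k. *)
Lemma sum_weight_le {K : numFieldType} (s : seq (nat * nat * nat)) :
  uniq s -> \sum_(t <- s) (2^-1 : K) ^+ degree t <= 2 * 2 * 2.
Proof.
move=> us.
pose N := (\max_(t <- s) degree t).+1.
have sN : {in s, forall t, degree t < N}%N.
  by move=> t ts; rewrite ltnS; exact: leq_bigmax_seq.
have h0 n : 0 <= (2^-1 : K) ^+ n by rewrite exprn_ge0 ?invr_ge0.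
rewrite (big_box _ us sN) big_mkcond /=.
apply: (@le_trans _ _ (\sum_(b : 'I_N * 'I_N * 'I_N)
    (2^-1) ^+ b.1.1 * (2^-1) ^+ b.1.2 * (2^-1) ^+ b.2)).
  apply: ler_sum => -[[i j] k] _ /=; case: ifP => _; last by rewrite !mulr_ge0.
  rewrite mul2n -addnn !exprD ler_wpM2l ?mulr_ge0 // ler_piMr //.
  by rewrite exprn_ile1 ?invr_ge0 // invf_le1 // ler1n.
rewrite -(pair_big predT predT (fun (b : 'I_N * 'I_N) (k : 'I_N) =>
  2^-1 ^+ b.1 * 2^-1 ^+ b.2 * 2^-1 ^+ k)) /=.
rewrite -(pair_big predT predT (fun i j : 'I_N =>
  \sum_(k < N) 2^-1 ^+ i * 2^-1 ^+ j * 2^-1 ^+ k)) /=.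
under eq_bigr do under eq_bigr do rewrite -mulr_sumr.
under eq_bigr do rewrite -mulr_suml -mulr_sumr.
rewrite -!mulr_suml.
by apply: ler_pM3; rewrite ?sumr_ge0 ?sum_half_le.
Qed.

(** The finite set against which all larger ones are compared consists of the
    triples of degree below N. Any other triples contribute little: of the weight
    4^-n in degree n, one factor 2^-n is at most 2^-N, and the other one has a sum
    over triples that is bounded by [sum_weight_le]. *)
Lemma unordered_sum_by_degree {R : realType} (x : nat * nat * nat -> R[i])
    (D s : R[i]) :
  (forall t, `|x t| <= D * (4^-1) ^+ degree t) ->
  (fun N => \sum_(b : 'I_N * 'I_N * 'I_N | (degree (coords b) < N)%N)
              x (coords b)) @ \oo --> s ->
  unordered_sum x s.
Proof.
move=> hx /cvg_seqP hs.
have D0 : 0 <= D.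
  have := le_trans (normr_ge0 _) (hx (0, 0, 0)%N).
  by rewrite /degree /= expr0 mulr1.
have [_ totallyF] := @totally_filter (nat * nat * nat)%type.
apply/cvgrPdist_lt => e e0.
have e20 : 0 < e / 2 by rewrite divr_gt0.
have [N1 h1] := hs _ e20.
have D1 : 0 < 1 + D * (2 * 2 * 2) by rewrite ltr_pwDl // !mulr_ge0.
have half1 : `|2^-1 : R[i]| < 1.
  by rewrite ger0_norm ?invr_ge0 // invf_lt1 // ltr1n.
have [N2 h2] := norm_expr_small half1 (divr_gt0 e20 D1).
pose N := maxn N1 N2.
pose L := [seq coords b |
  b <- enum [pred b : 'I_N * 'I_N * 'I_N | (degree (coords b) < N)%N]].
have memL t : (t \in L) = (degree t < N)%N.
  apply/mapP/idP => [[b + ->]|tN]; first by rewrite mem_enum.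
  by have [b bt] := coords_onto tN; exists b; rewrite // mem_enum inE bt.
exists (seq_fset tt L) => // A LA.
have {}LA t : (degree t < N)%N -> t \in A.
  by move=> tN; apply: (fsubsetP LA); rewrite seq_fsetE memL.
rewrite /partial_sum -(big_seq_fsetE _ A predT x) /=.
rewrite (bigID (fun t => degree t < N)%N) /=.
have -> : \sum_(t <- A | (degree t < N)%N) x t =
    \sum_(b : 'I_N * 'I_N * 'I_N | (degree (coords b) < N)%N) x (coords b).
  rewrite -big_filter (@big_box _ _ N) ?filter_uniq ?fset_uniq //; last first.
    by move=> t; rewrite mem_filter => /andP[].
  by apply: eq_bigl => b; rewrite mem_filter andb_idr // => /LA.
rewrite opprD addrA; apply: le_lt_trans (ler_normB _ _) _; rewrite [ltRHS]splitr.
apply: ltrD; first by rewrite h1 // leq_maxl.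
apply: (@le_lt_trans _ _ (D * 2^-1 ^+ N *
    \sum_(t <- A | ~~ (degree t < N)%N) 2^-1 ^+ degree t)).
  apply: le_trans (ler_norm_sum _ _ _) _; rewrite mulr_sumr.
  apply: ler_sum => t.
  rewrite -leqNgt => Nt; apply: le_trans (hx t) _; rewrite -mulrA ler_wpM2l //.
  have -> : (4^-1 : R[i]) = 2^-1 * 2^-1 by rewrite -invfM -natrM.
  rewrite exprMn ler_wpM2r ?exprn_ge0 ?invr_ge0 // ler_wiXn2l ?invr_ge0 //.
  by rewrite invf_le1 // ler1n.
rewrite -big_filter.
apply: (@le_lt_trans _ _ (D * 2^-1 ^+ N * (2 * 2 * 2))).
  rewrite ler_wpM2l ?mulr_ge0 ?exprn_ge0 ?invr_ge0 //.
  by rewrite sum_weight_le // filter_uniq // fset_uniq.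
have := h2 N (leq_maxr _ _); rewrite ger0_norm ?invr_ge0 // ltr_pdivlMr //.
by apply: le_lt_trans; rewrite mulrAC mulrC ler_wpM2l ?exprn_ge0 ?invr_ge0 // lerDr.
Qed.

(** * The triple series *)

Definition term {R : realType} (q u : R[i]) (t : nat * nat * nat) : R[i] :=
  let: (i, j, k) := t in
  q ^ ((3 * i ^ 2 + 3 * j ^ 2 + 4 * k ^ 2
        + 2 * i * j + 4 * i * k + 4 * j * k)%N%:Z - (2 * j)%N%:Z)
  * u ^+ (i + j + 2 * k)
  / (qpoch (q ^+ 4) (q ^+ 4) i * qpoch (q ^+ 4) (q ^+ 4) j
     * qpoch (q ^+ 4) (q ^+ 4) k).

(** Completing the square: the quadratic form in the exponent of q exceeds the
    square of the degree by 2 i^2 + 2 j (j - 1), which is the exponent carried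
    by the coefficients at p = q^2. *)
Lemma termE {R : realType} (q u : R[i]) t : term q u t =
  q ^+ (degree t ^ 2) * u ^+ degree t *
  (odd_coef (q ^+ 2) t.1.1 * even_coef (q ^+ 2) t.1.2
   * square_coef (q ^+ 2) t.2).
Proof.
case: t => [[i j] k] /=.
have -> : ((3 * i ^ 2 + 3 * j ^ 2 + 4 * k ^ 2
      + 2 * i * j + 4 * i * k + 4 * j * k)%N%:Z - (2 * j)%N%:Z
    = ((i + j + 2 * k) ^ 2 + 2 * i ^ 2 + 2 * (j * j.-1))%N%:Z).
  have e : (3 * i ^ 2 + 3 * j ^ 2 + 4 * k ^ 2
      + 2 * i * j + 4 * i * k + 4 * j * k
    = (i + j + 2 * k) ^ 2 + 2 * i ^ 2 + 2 * (j * j.-1) + 2 * j)%N.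
    by case: j => [|j] /=; rewrite -!mulnn; lia.
  by rewrite e PoszD addrK.
have -> : q ^ ((i + j + 2 * k) ^ 2 + 2 * i ^ 2 + 2 * (j * j.-1))%N%:Z
    = q ^+ ((i + j + 2 * k) ^ 2) * (q ^+ 2) ^+ (i ^ 2)
      * (q ^+ 2) ^+ (j * j.-1).
  by rewrite -exprnP -!exprM -!exprD.
rewrite /odd_coef /even_coef /square_coef -[(q ^+ 2) ^+ 2]exprM !invfM.
move: (u ^+ _) (q ^+ ((i + j + 2 * k) ^ 2)) (_ ^+ (i ^ 2)) (_ ^+ (j * _)).
move: (qpoch _ _ i)^-1 (qpoch _ _ j)^-1 (qpoch _ _ k)^-1 => x y z a b c d.
by ring.
Qed.

Lemma norm_termE {R : realType} (q u : R[i]) i j k : `|term q u (i, j, k)| =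
  (`|q| ^+ ((i + j + 2 * k) ^ 2) * `|q| ^+ (2 * (i ^ 2 + j * j.-1))) *
  (`|(qpoch (q ^+ 4) (q ^+ 4) i)^-1| * `|(qpoch (q ^+ 4) (q ^+ 4) j)^-1|
     * `|(qpoch (q ^+ 4) (q ^+ 4) k)^-1|) * `|u| ^+ (i + j + 2 * k).
Proof.
rewrite termE /degree /= /odd_coef /even_coef /square_coef.
have -> : (q ^+ 2) ^+ 2 = q ^+ 4 by rewrite -exprM.
have -> : `|q| ^+ (2 * (i ^ 2 + j * j.-1)) =
    (`|q| ^+ 2) ^+ (i ^ 2) * (`|q| ^+ 2) ^+ (j * j.-1).
  by rewrite -!exprM -exprD mulnDr.
rewrite !normrM !normrX.
move: (`|u| ^+ _) (`|q| ^+ ((i + j + 2 * k) ^ 2)) (_ ^+ (i ^ 2)) (_ ^+ (j * _)).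
move: `|(qpoch _ _ i)^-1| `|(qpoch _ _ j)^-1| `|(qpoch _ _ k)^-1|.
by move=> x y z a b c d; ring.
Qed.

(** By [squares_le_degree] the term has a Gaussian factor in each coordinate,
    which absorbs the geometric growth of everything else in that coordinate,
    the weight 4^n included. *)
Lemma norm_term_le {R : realType} (q u : R[i]) : `|q| < 1 ->
  exists D : R[i], forall t, `|term q u t| <= D * 4^-1 ^+ degree t.
Proof.
move=> q1; have k0 : 0 < 1 - `|q ^+ 4| by rewrite subr_gt0 norm_expr_lt1.
pose K := (1 - `|q ^+ 4|)^-1.
have K0 : 0 <= K by rewrite invr_ge0 ltW.
pose U := 4 * (1 + `|u|).
have U1 : 1 <= U by rewrite mulr_ege1 ?ler1n // lerDl.
have U0 : 0 <= U by apply: le_trans U1.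
(* The third coordinate counts twice in the degree, whence the square of U. *)
have M0 : 0 <= K * U ^+ 2 by rewrite mulr_ge0 // exprn_ge0.
have [D D0 hD] := gauss_bound q1 M0.
exists (D * D * D) => -[[i j] k].
rewrite exprVn ler_pdivlMr ?exprn_gt0 // norm_termE /degree.
have exponent_le :
    `|q| ^+ ((i + j + 2 * k) ^ 2) * `|q| ^+ (2 * (i ^ 2 + j * j.-1))
    <= `|q| ^+ (i ^ 2) * `|q| ^+ (j ^ 2) * `|q| ^+ (k ^ 2).
  rewrite -!exprD; apply: ler_wiXn2l => //; first exact: ltW.
  by apply: leq_trans (leq_addr _ _); exact: squares_le_degree.
have qpochs_le :
    `|(qpoch (q ^+ 4) (q ^+ 4) i)^-1| * `|(qpoch (q ^+ 4) (q ^+ 4) j)^-1|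
      * `|(qpoch (q ^+ 4) (q ^+ 4) k)^-1| <= K ^+ i * K ^+ j * K ^+ k.
  by apply: ler_pM3 => //; exact: norm_inv_qpoch_le (norm_expr_lt1 3 q1).
have weight_le : `|u| ^+ (i + j + 2 * k) * 4 ^+ (i + j + 2 * k)
    <= (U ^+ 2) ^+ i * (U ^+ 2) ^+ j * (U ^+ 2) ^+ k.
  rewrite -exprMn -!exprM -!exprD.
  apply: (@le_trans _ _ (U ^+ (i + j + 2 * k))).
    have u4 : `|u| * 4 <= U by rewrite /U mulrC ler_wpM2l // lerDr.
    by apply: lerXn2r u4; rewrite ?nnegrE // mulr_ge0.
  by apply: ler_weXn2l => //; exact: degree_le_double.
rewrite -[leLHS]mulrA; apply: le_trans (_ : _ <=
  (`|q| ^+ (i ^ 2) * `|q| ^+ (j ^ 2) * `|q| ^+ (k ^ 2))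
  * (K ^+ i * K ^+ j * K ^+ k)
  * ((U ^+ 2) ^+ i * (U ^+ 2) ^+ j * (U ^+ 2) ^+ k)) _.
  apply: (ler_pM3 _ _ _ exponent_le qpochs_le weight_le).
  - by apply: mulr_ge0; exact: exprn_ge0.
  - by apply: mulr_ge0 => //; exact: mulr_ge0.
  - by apply: mulr_ge0; exact: exprn_ge0.
have regroup (a b c a' b' c' a'' b'' c'' : R[i]) :
   a * b * c * (a' * b' * c') * (a'' * b'' * c'') =
   (a * (a' * a'')) * (b * (b' * b'')) * (c * (c' * c'')) by ring.
rewrite regroup; apply: ler_pM3; rewrite -exprMn //.
all: by apply: mulr_ge0; exact: exprn_ge0.
Qed.

Lemma sum_term_below_degree {R : realType} (q u : R[i]) N : `|q| < 1 ->
  \sum_(b : 'I_N * 'I_N * 'I_N | (degree (coords b) < N)%N)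
     term q u (coords b) = euler_sum q u N.
Proof.
move=> q1; rewrite -sum_by_degree; apply: eq_bigr => n _.
have q2_neq1 m : (q ^+ 2) ^+ m.+1 != 1 by exact: expr_neq1 (norm_expr_lt1 1 q1).
rewrite /euler_coef -(sum_fixed_degree q2_neq1 (ltn_ord n)).
rewrite mulr_sumr mulr_suml.
by apply: eq_bigr => b /eqP bn; rewrite termE bn mulrAC.
Qed.

(* The exponent of q is an integer, since "- 2 j" would truncate in nat. *)
Theorem theorem6p1 (R : realType) (q u : R[i]) (hq0 : 0 < `|q|)
    (hq1 : `|q| < 1) :
  unordered_sum
    (fun t : nat * nat * nat => let: (i, j, k) := t in
       q ^ ((3 * i ^ 2 + 3 * j ^ 2 + 4 * k ^ 2
             + 2 * i * j + 4 * i * k + 4 * j * k)%N%:Z - (2 * j)%N%:Z)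
       * u ^+ (i + j + 2 * k)
       / (qpoch (q ^+ 4) (q ^+ 4) i * qpoch (q ^+ 4) (q ^+ 4) j
          * qpoch (q ^+ 4) (q ^+ 4) k))
    (qpoch_inf (- u * q) (q ^+ 2)).
Proof.
change (unordered_sum (term q u) (qpoch_inf (- u * q) (q ^+ 2))).
have [D hD] := norm_term_le u hq1.
apply: (unordered_sum_by_degree hD).
under eq_fun do rewrite sum_term_below_degree //.
exact: cvg_euler_sum.
Qed.
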